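(* Let $\alpha\in(0,1)$. The density of the random variable $W_\alpha$ is log-convex on its domain of definition, i.e. on the half-line that is the support of $W_\alpha$.
   Context: For $\alpha\in(0,1)$ put $\beta=1-\alpha$ and $$b_\alpha(u)=\Big(\frac{\sin u}{\sin(\alpha u)}\Big)^{\alpha}\Big(\frac{\sin u}{\sin(\beta u)}\Big)^{\beta},\qquad u\in(0,\pi).$$ The function $b_\alpha$ is decreasing on $(0,\pi)$. Let $U$ be uniformly distributed on $(0,\pi)$ and set $$V_\alpha=b_\alpha(U)^{-1/\beta},\qquad W_\alpha=\log V_\alpha=-\frac1\beta\log b_\alpha(U).$$ The support of $V_\alpha$ is $[\beta\alpha^{\alpha/\beta},\infty)$ and the support of $W_\alpha$ is $[\log(\beta\alpha^{\alpha/\beta}),\infty)$. A positive function is log-convex if its logarithm is convex. *)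

(* Defs.v *)
From HB Require Import structures.
From mathcomp Require Import all_boot all_order all_algebra.
From mathcomp Require Import all_classical all_reals all_analysis measurable_realfun.

Set Implicit Arguments.
Unset Strict Implicit.
Unset Printing Implicit Defensive.

Import Order.TTheory GRing.Theory Num.Theory.
Import numFieldNormedType.Exports.

Local Open Scope classical_set_scope.
Local Open Scope ring_scope.

Section functions.
Context {R : realType}.
Implicit Types alpha u : R.

(* The formulas below are only meaningful for u in (0, pi). *)
Definition b_fun alpha u : R :=
  (sin u / sin (alpha * u)) `^ alpha
  * (sin u / sin ((1 - alpha) * u)) `^ (1 - alpha).

Definition v_fun alpha u : R := b_fun alpha u `^ (- (1 - alpha)^-1).

Definition w_fun alpha u : R := ln (v_fun alpha u).

Lemma measurable_invr : measurable_fun [set: R] (@GRing.inv R).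
Proof.
have -> : @GRing.inv R = fun x => x * (x ^+ 2) `^ (-1).
  apply/funext => x; rewrite powR_inv1 ?sqr_ge0//.
  have [->|x0] := eqVneq x 0; first by rewrite invr0 mul0r.
  by rewrite expr2 invfM mulrA divff// mul1r.
apply: measurable_funM => //.
apply: (measurableT_comp (measurable_powR (-1))).
exact: measurable_funX.
Qed.

Lemma measurable_b_fun alpha : measurable_fun [set: R] (b_fun alpha).
Proof.
have msin c : measurable_fun [set: R] (fun u => sin (c * u)).
  apply: measurableT_comp; last exact: measurable_funM.
  by apply: continuous_measurable_fun; exact: continuous_sin.
have msin1 : measurable_fun [set: R] (@sin R).
  by apply: continuous_measurable_fun; exact: continuous_sin.
by apply: measurable_funM; (apply: (measurableT_comp (measurable_powR _)));
  apply: measurable_funM => //; exact: (measurableT_comp measurable_invr).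
Qed.

Lemma measurable_w_fun alpha : measurable_fun [set: R] (w_fun alpha).
Proof.
apply: (measurableT_comp (@measurable_ln R)).
apply: (measurableT_comp (measurable_powR _)).
exact: measurable_b_fun.
Qed.

End functions.

Section random_variables.
Context {R : realType} {d : measure_display} {T : measurableType d}.
Context {P : probability T R}.

(* Laws are compared on measurable sets only: [uniform_prob] is also defined,
   but carries no information, on non-measurable sets.  [uniform_prob] is built
   from a density supported by the closed interval; as endpoints are negligible
   this is the uniform law on (0, pi). *)
Definition uniform_0pi (U : {RV P >-> R}) :=
  forall A : set R, measurable A ->
    distribution P U A = uniform_prob (pi_gt0 R) A.

Definition V_rv (alpha : R) (U : {RV P >-> R}) : T -> R :=
  fun t => v_fun alpha (U t).

Definition W_rv (alpha : R) (U : {RV P >-> R}) : T -> R :=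
  fun t => ln (V_rv alpha U t).

Lemma measurable_W_rv alpha U : measurable_fun [set: T] (W_rv alpha U).
Proof. exact: (measurableT_comp (measurable_w_fun alpha)). Qed.

HB.instance Definition _ alpha U :=
  @isMeasurableFun.Build _ _ T R (W_rv alpha U) (measurable_W_rv alpha U).

End random_variables.

Definition W_support {R : realType} (alpha : R) : set R :=
  `[ln ((1 - alpha) * alpha `^ (alpha / (1 - alpha))), +oo[.

Local Open Scope ereal_scope.

Definition is_density {R : realType} (mu : set R -> \bar R) (f : R -> \bar R) :=
  [/\ measurable_fun [set: R] f,
      forall x, 0 <= f x &
      forall A, measurable A -> mu A = \int[lebesgue_measure]_(x in A) f x].

(* Convexity in the extended-valued sense; here 0 * +oo = 0. *)
Definition convex_on {R : realType} (D : set R) (g : R -> \bar R) :=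
  forall x y t : R, D x -> D y -> (0 <= t <= 1)%R ->
    g (t * x + (1 - t) * y)%R <= t%:E * g x + (1 - t)%:E * g y.

(* Densities are extended-valued because the density of W_rv tends to +oo at the
   left endpoint of the half-line [W_support], so that no real-valued version is
   log-convex up to that endpoint.  [lne] is the extended logarithm. *)
Definition log_convex_on {R : realType} (D : set R) (f : R -> \bar R) :=
  (forall x, D x -> 0 < f x) /\ convex_on D (fun x => lne (f x)).

(* Main.v *)
Require Import Defs.
From HB Require Import structures.
From mathcomp Require Import all_boot all_order all_algebra.
From mathcomp Require Import all_classical all_reals all_analysis.
From mathcomp Require Import measurable_realfun ring lra.

(** Put [a = alpha u], [b = beta u] and
   [h = (cot a + cot b) / (1 + (alpha cot a - beta cot b) ^ 2)]. Expanding
   [cot u = cot (a + b)] gives [W' = 1 / (beta h)], so at the point [W(u)] the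
   density is [beta h(u) / pi] and the derivative of its logarithm is
   [beta h'(u)]: log-convexity means that [h] is convex on [(0, pi)].

   With [N = cot a + cot b], [D = alpha cot a - beta cot b], [p = alpha beta]
   and [d = beta - alpha], the functions [N], [D] solve a polynomial
   differential system, and [k = h D] satisfies
   [h' = -1 - p h^2 + 3 p k^2 - 2 d k], hence
   [h'' = - 2 p h h' - 2 k' (d - 3 p k)]. As [h] is even in [d], take [d >= 0].
   A first comparison argument yields [3 p k <= d], whence [h' <= 0]; a second
   one yields [k' <= 0]; so all the terms of [h''] are nonnegative. *)

Set Implicit Arguments.
Unset Strict Implicit.
Unset Printing Implicit Defensive.

Import Order.TTheory GRing.Theory Num.Theory.
Import numFieldNormedType.Exports.

Local Open Scope classical_set_scope.
Local Open Scope ring_scope.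

(** * Derivatives and monotonicity *)

Section calculus.
Context {R : realType}.
Implicit Types (f df : R -> R) (a b : R).

Lemma is_derive_continuous f (x l : R) : is_derive x 1 f l -> {for x, continuous f}.
Proof.
by move=> dfx; apply: differentiable_continuous; apply/derivable1_diffP; apply: ex_derive.
Qed.

Lemma MVT_cc f df a b : a < b ->
  (forall x, a <= x <= b -> is_derive x 1 f (df x)) ->
  exists2 c, a < c < b & f b - f a = df c * (b - a).
Proof.
move=> ab dfab; have [x|x|c] := @MVT _ f df a b ab; last first.
- by rewrite in_itv/= => cab E; exists c.
- apply: derivable_within_continuous => y; rewrite in_itv/= => /dfab ?.
  exact: ex_derive.
- by rewrite in_itv/= => /andP[/ltW ax /ltW xb]; apply: dfab; rewrite ax.
Qed.

Lemma derive_ge0_homo f df (a b : R) :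
  (forall x, a < x < b -> is_derive x 1 f (df x)) ->
  (forall x, a < x < b -> 0 <= df x) ->
  forall x y, a < x -> x <= y -> y < b -> f x <= f y.
Proof.
move=> dfab df0 x y ax; rewrite le_eqVlt => /predU1P[->//|xy] yb.
have [z /andP[xz zy]|c /andP[xc cy] E] := @MVT_cc f df x y xy.
  by apply: dfab; rewrite (lt_le_trans ax)//= (le_lt_trans zy).
rewrite -subr_ge0 E; apply: mulr_ge0; last by rewrite subr_ge0 ltW.
apply: df0.
by rewrite (lt_trans ax)//= (lt_trans cy).
Qed.

Lemma derive_gt0_homo f df (a b : R) :
  (forall x, a < x < b -> is_derive x 1 f (df x)) ->
  (forall x, a < x < b -> 0 < df x) ->
  forall x y, a < x -> x < y -> y < b -> f x < f y.
Proof.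
move=> dfab df0 x y ax xy yb.
have [z /andP[xz zy]|c /andP[xc cy] E] := @MVT_cc f df x y xy.
  by apply: dfab; rewrite (lt_le_trans ax)//= (le_lt_trans zy).
rewrite -subr_gt0 E; apply: mulr_gt0; last by rewrite subr_gt0.
apply: df0.
by rewrite (lt_trans ax)//= (lt_trans cy).
Qed.

(* After the last point where [f] is at least half of a negative value
   [f u], [f] is negative, hence nondecreasing. *)
Lemma ge0_of_derive_ge0_where_lt0 f df (b : R) :
  (forall u, 0 < u < b -> is_derive u 1 f (df u)) ->
  (forall u, 0 < u < b -> f u < 0 -> 0 <= df u) ->
  (forall e, 0 < e -> exists2 r, 0 < r & forall u, 0 < u < r -> u < b -> - e <= f u) ->
  forall u, 0 < u < b -> 0 <= f u.
Proof.
move=> dfE df0 flim u0 /andP[u00 u0b]; rewrite leNgt; apply/negP => fu0.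
have [|r r0 hr] := flim (- (f u0 / 2)); first by lra.
pose v0 := Num.min (r / 2) (u0 / 2).
have v0gt0 : 0 < v0 by rewrite lt_min; apply/andP; split; lra.
have v0r : v0 < r by rewrite /v0 gt_min; apply/orP; left; lra.
have v0u : v0 < u0 by rewrite /v0 gt_min; apply/orP; right; lra.
have fv0 : f u0 / 2 <= f v0.
  by rewrite -[leLHS]opprK; apply: hr; [rewrite v0gt0|exact: lt_trans u0b].
pose S := [set v | v0 <= v <= u0 /\ f u0 / 2 <= f v].
have Sv0 : S v0 by split => //; rewrite lexx ltW.
have ubS : ubound S u0 by move=> v [/andP[]].
have hsS : has_sup S by split; [exists v0|exists u0].
pose v := sup S.
have v0v : v0 <= v by apply: ub_le_sup => //; exists u0.
have vu0 : v <= u0 by apply: ge_sup => //; exists v0.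
have dfv z : v0 <= z <= u0 -> is_derive z 1 f (df z).
  by move=> /andP[z1 z2]; apply: dfE; rewrite (lt_le_trans v0gt0)//= (le_lt_trans z2).
(* By continuity the supremum [v] itself belongs to [S]. It differs from [u0] because
   [f u0 < f u0 / 2]. *)
have fv : f u0 / 2 <= f v.
  rewrite leNgt; apply/negP => fvlt.
  have cf : {for v, continuous f}.
    by apply: (@is_derive_continuous _ _ (df v)); apply: dfv; rewrite v0v.
  have : \forall z \near v, f z < f u0 / 2.
    exact: (cvgr_lt (f v) cf).
  rewrite -nbhs_nearE => /nbhs_ballP[e /= e0 he].
  have [z [Sz1 Sz2] vez] : exists2 z, S z & v - e < z.
    by apply: sup_adherent.
  have zv : z <= v by apply: ub_le_sup => //; exists u0.
  have : f z < f u0 / 2.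
    by apply: he; rewrite /ball/= ger0_norm ?subr_ge0//; lra.
  by rewrite ltNge Sz2.
have vltu0 : v < u0.
  rewrite lt_neqAle vu0 andbT; apply/eqP => vE.
  by move: fv; rewrite vE; lra.
have [z /andP[z1 z2]|c /andP[vc cu0] E] := @MVT_cc f df v u0 vltu0.
  by apply: dfv; rewrite z2 (le_trans v0v).
have fc : f c < 0.
  rewrite ltNge; apply/negP => fc; suff : c <= v by rewrite leNgt vc.
  apply: ub_le_sup; first by exists u0.
  split; last lra.
  by rewrite (le_trans v0v (ltW vc)) ltW.
have : 0 <= f u0 - f v.
  rewrite E; apply: mulr_ge0; last lra.
  apply: df0 => //; rewrite (lt_le_trans v0gt0) ?(le_trans v0v) ?ltW//=.
  exact: lt_trans u0b.
lra.
Qed.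

End calculus.

Section rules.
Context {R : realType}.
Implicit Types (f g : R -> R) (x k : R).

Lemma is_derive_add f g x a b : is_derive x 1 f a -> is_derive x 1 g b ->
  is_derive x 1 (fun y => f y + g y) (a + b).
Proof. exact: is_deriveD. Qed.

Lemma is_derive_opp f x a : is_derive x 1 f a ->
  is_derive x 1 (fun y => - f y) (- a).
Proof. exact: is_deriveN. Qed.

Lemma is_derive_sub f g x a b : is_derive x 1 f a -> is_derive x 1 g b ->
  is_derive x 1 (fun y => f y - g y) (a - b).
Proof. exact: is_deriveB. Qed.

Lemma is_derive_mul f g x a b : is_derive x 1 f a -> is_derive x 1 g b ->
  is_derive x 1 (fun y => f y * g y) (a * g x + f x * b).
Proof.
move=> fa gb; apply: (is_derive_eq (is_deriveM fa gb)).
by rewrite /GRing.scale/=; ring.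
Qed.

Lemma is_derive_const k x : is_derive x 1 (fun=> k) 0.
Proof. exact: is_derive_cst. Qed.

Lemma is_derive_scale f k x a : is_derive x 1 f a ->
  is_derive x 1 (fun y => k * f y) (k * a).
Proof. exact: is_deriveZ. Qed.

Lemma is_derive_div f g x a b :
  is_derive x 1 f a -> is_derive x 1 g b -> g x != 0 ->
  is_derive x 1 (fun y => f y / g y) ((a * g x - f x * b) / g x ^+ 2).
Proof.
move=> fa gb gx; apply: (is_derive_eq (is_derive_mul fa (is_deriveV gx gb))).
by rewrite /GRing.scale/=; field.
Qed.

Lemma is_derive_sin_scale k x : is_derive x 1 (fun y => sin (k * y)) (k * cos (k * x)).
Proof.
rewrite mulrC; apply: is_derive1_comp.
by apply: (is_derive_eq (is_derive_scale k (is_derive_id x 1))); rewrite mulr1.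
Qed.

Lemma is_derive_cos_scale k x :
  is_derive x 1 (fun y => cos (k * y)) (- k * sin (k * x)).
Proof.
rewrite mulNr mulrC -mulNr; apply: is_derive1_comp.
by apply: (is_derive_eq (is_derive_scale k (is_derive_id x 1))); rewrite mulr1.
Qed.

End rules.

(** * Convexity of the profile [h] *)

Section trigo.
Context {R : realType}.
Implicit Types (d t u x : R).

Lemma ltr_cos_scale d x : 0 <= d < 1 -> 0 < x <= pi -> cos x < cos (d * x).
Proof.
move=> /andP[d0 d1] /andP[x0 xpi].
have dx : d * x < x by rewrite gtr_pMl.
by rewrite ltr_cos// in_itv/= ?(ltW x0)// mulr_ge0 ?(ltW x0)//= (le_trans _ xpi)// ltW.
Qed.

(** The function sin (t y) - t sin y vanishes at 0 and has derivative t (cos (t y) - cos y) >= 0. *)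
Lemma ler_sin_scale t x : 0 <= t <= 1 -> 0 <= x <= pi -> t * sin x <= sin (t * x).
Proof.
move=> /andP[t0]; rewrite le_eqVlt => /predU1P[->|t1]; first by rewrite !mul1r.
move=> /andP[]; rewrite le_eqVlt => /predU1P[<-|x0]; first by rewrite !mulr0 sin0 mulr0.
move=> xpi; pose f y := sin (t * y) - t * sin y.
have [y _|c /andP[c0 cx]] :=
    @MVT_cc _ f (fun y => t * cos (t * y) - t * cos y) 0 x x0.
  exact: (is_derive_sub (is_derive_sin_scale t y) (is_derive_scale t (is_derive_sin y))).
rewrite /f !mulr0 sin0 mulr0 !subr0 => E.
rewrite -subr_ge0 E -mulrBr; apply: mulr_ge0; last exact: ltW.
by apply: mulr_ge0 => //; rewrite subr_ge0 ltW// ltr_cos_scale ?t0// c0 (le_trans _ xpi)// ltW.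
Qed.

Lemma sin_le_id x : 0 <= x -> sin x <= x.
Proof.
rewrite le_eqVlt => /predU1P[<-|x0]; first by rewrite sin0.
have [c _] := @MVT_cc _ (@sin R) (@cos R) 0 x x0.
rewrite sin0 !subr0 => ->.
by rewrite ger_pMl// cos_le1.
Qed.

End trigo.

(** * Differential system of the cotangent sum and difference *)

Section cotangents.
Context {R : realType}.
Implicit Types (d u : R).

(* With [a = (1 - d) u / 2] and [b = (1 + d) u / 2], [cos_gap d u] is
   [2 sin a sin b], so that [cotS d u] is [cot a + cot b], and [cotD d u] is
   [(1 - d) / 2 * cot a - (1 + d) / 2 * cot b]. For [d = 1 - 2 alpha] this is
   [a = alpha u], [b = (1 - alpha) u] and [pr d = alpha (1 - alpha)]. *)
Definition cos_gap d u := cos (d * u) - cos u.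
Definition sin_gap d u := sin (d * u) - d * sin u.
Definition cotS d u := 2 * sin u / cos_gap d u.
Definition cotD d u := sin_gap d u / cos_gap d u.
Definition pr d : R := (1 - d ^+ 2) / 4.

Lemma cos_gap_gt0 d u : 0 <= d < 1 -> 0 < u <= pi -> 0 < cos_gap d u.
Proof. by move=> d01 u0pi; rewrite subr_gt0 ltr_cos_scale. Qed.

Lemma is_derive_cos_gap d u :
  is_derive u 1 (cos_gap d) (sin u - d * sin (d * u)).
Proof.
apply: (is_derive_eq (is_derive_sub (is_derive_cos_scale d u) (is_derive_cos u))).
by ring.
Qed.

Lemma is_derive_sin_gap d u : is_derive u 1 (sin_gap d) (d * cos_gap d u).
Proof.
apply: (is_derive_eq (is_derive_sub (is_derive_sin_scale d u)
  (is_derive_scale d (is_derive_sin u)))).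
by rewrite /cos_gap; ring.
Qed.

Lemma sqr_sin_cos d : cos d ^+ 2 + sin d ^+ 2 = 1 :> R.
Proof. by rewrite cos2sin2 subrK. Qed.

Variables (d u : R).
Hypotheses (d01 : 0 <= d < 1) (u0pi : 0 < u < pi).
Local Notation N := (cotS d u).
Local Notation D := (cotD d u).
Local Notation p := (pr d).

Let gap_gt0 : 0 < cos_gap d u.
Proof. by case/andP: u0pi => u0 upi; apply: cos_gap_gt0; rewrite // u0 ltW. Qed.
Let gap_neq0 : cos_gap d u != 0. Proof. by rewrite gt_eqF. Qed.

Lemma pr_gt0 : 0 < p.
Proof. rewrite /pr; case/andP: d01 => d0 d1; nra. Qed.

Lemma cotS_gt0 : 0 < N.
Proof.
by rewrite /cotS divr_gt0// mulr_gt0// sin_gt0_pi.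
Qed.

(** The derivative is rewritten through [N] and [D] because [cos_gap] serves later as a weight,
    through its logarithmic derivative. *)
Lemma is_derive_cos_gapE :
  is_derive u 1 (cos_gap d) (cos_gap d u * (2 * p * N - d * D)).
Proof.
apply: (is_derive_eq (is_derive_cos_gap d u)).
by rewrite /cotS /cotD /pr /sin_gap; field.
Qed.

(** With x = cot a, y = cot b, alpha = (1 - d) / 2 and beta = (1 + d) / 2, the derivative is -(1 +
    alpha x^2 + beta y^2), and alpha x^2 + beta y^2 = (alpha x - beta y)^2 + alpha beta (x +
    y)^2. *)
Lemma is_derive_cotS : is_derive u 1 (cotS d) (- (1 + D ^+ 2 + p * N ^+ 2)).
Proof.
apply: (is_derive_eq (is_derive_div
  (is_derive_scale 2 (is_derive_sin u)) (is_derive_cos_gap d u) gap_neq0)).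
apply: (mulIf (expf_neq0 2 gap_neq0)).
rewrite mulfVK ?expf_neq0//.
transitivity (- (cos_gap d u ^+ 2 + sin_gap d u ^+ 2 + p * (2 * sin u) ^+ 2)).
  rewrite /cos_gap /sin_gap /pr.
  by have := sqr_sin_cos u; have := sqr_sin_cos (d * u); lra.
by rewrite /cotS /cotD; field.
Qed.

Lemma is_derive_cotD : is_derive u 1 (cotD d) (d * (1 + D ^+ 2) - 2 * p * N * D).
Proof.
apply: (is_derive_eq (is_derive_div
  (is_derive_sin_gap d u) (is_derive_cos_gap d u) gap_neq0)).
by rewrite /cotD /cotS /pr /sin_gap; field.
Qed.

Lemma cotD_ge0 : 0 <= D.
Proof.
case/andP: d01 => d0 d1; case/andP: u0pi => u0 upi.
apply: divr_ge0; last exact: ltW.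
by rewrite subr_ge0 ler_sin_scale// ?d0 ?ltW ?(ltW u0).
Qed.

(* In the notations above this quantity, the derivative of [cotD d], is
   [((1 + d) / (2 sin b)) ^ 2 - ((1 - d) / (2 sin a)) ^ 2]. *)
Lemma derive_cotD_ge0 : 0 <= d * (1 + D ^+ 2) - 2 * p * N * D.
Proof.
case/andP: d01 => d0 d1; case/andP: u0pi => u0 upi.
pose b := (1 + d) / 2 * u; pose a := (1 - d) / 2 * u.
have uE : u = a + b by rewrite /a /b; lra.
have duE : d * u = b - a by rewrite /a /b; lra.
have b0pi : 0 < b < pi by rewrite /b; apply/andP; split; nra.
have sb : 0 < sin b by exact: sin_gt0_pi.
(* [a] is [b] times a factor in [0, 1], so [ler_sin_scale] applies. *)
have sab : (1 - d) * sin b <= (1 + d) * sin a.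
  have -> : a = (1 - d) / (1 + d) * b by rewrite /a /b; field; rewrite gt_eqF// ltr_wpDr.
  have /(ler_wpM2l (_ : 0 <= 1 + d)) : (1 - d) / (1 + d) * sin b <= sin ((1 - d) / (1 + d) * b).
    apply: ler_sin_scale; last by case/andP: b0pi => /ltW -> /ltW.
    by rewrite divr_ge0 ?ler_pdivrMr; lra.
  rewrite mulrA mulrCA divff ?mulr1; last by rewrite gt_eqF// ltr_wpDr.
  by apply; lra.
have -> : d * (1 + D ^+ 2) - 2 * p * N * D =
    (d * cos_gap d u ^+ 2 - sin_gap d u * (sin u - d * sin (d * u))) / cos_gap d u ^+ 2.
  by rewrite /cotD /cotS /pr /sin_gap; field.
apply: divr_ge0; last exact: sqr_ge0.
(* The factors equal to 1 make both sides homogeneous, so that [ring] needs no Pythagorean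
   relation. *)
have -> : d * cos_gap d u ^+ 2 - sin_gap d u * (sin u - d * sin (d * u)) =
    ((1 + d) * sin a) ^+ 2 * (cos b ^+ 2 + sin b ^+ 2)
    - ((1 - d) * sin b) ^+ 2 * (cos a ^+ 2 + sin a ^+ 2).
  rewrite /cos_gap /sin_gap duE {1 2 3}uE cosB cosD sinB sinD; ring.
rewrite !sqr_sin_cos !mulr1 subr_ge0 ler_sqr// nnegrE.
  by apply: mulr_ge0; lra.
by apply: le_trans sab; apply: mulr_ge0; lra.
Qed.

(** Serves to bound [D] near 0 in [kprof_le]. The function [f] vanishes at 0 and has derivative d x
    (sin x - d sin (d x)), which is nonnegative as the sine increases up to pi / 2. *)
Lemma cotD_le : u <= pi / 2 -> D <= d * u.
Proof.
move=> upi2; case/andP: d01 => d0 d1; case/andP: u0pi => u0 upi.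
rewrite /cotD ler_pdivrMr//.
pose f x := d * x * cos_gap d x - sin_gap d x.
have [x _|c /andP[c0 cu]] :=
  @MVT_cc _ f (fun x => d * 1 * cos_gap d x + d * x * (sin x - d * sin (d * x))
    - d * cos_gap d x) 0 u u0.
  exact: (is_derive_sub (is_derive_mul (is_derive_scale d (is_derive_id x 1))
    (is_derive_cos_gap d x)) (is_derive_sin_gap d x)).
have sin_gap0 : sin_gap d 0 = 0 by rewrite /sin_gap !mulr0 sin0 mulr0 subr0.
rewrite {2}/f mulr0 mul0r sin_gap0 !subr0 => E.
rewrite -subr_ge0 [leRHS]E; apply: mulr_ge0; last exact: ltW.
have : d * sin (d * c) <= sin c.
  apply: (@le_trans _ _ (sin (d * c))).
    by apply: ler_piMl; [apply: sin_ge0_pi; apply/andP; split; nra|exact: ltW].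
  rewrite leNgt ltr_sin ?in_itv/= -?leNgt; first by nra.
    by apply/andP; split; nra.
  by apply/andP; split; nra.
move: (mulr_ge0 d0 (ltW c0)); nra.
Qed.

End cotangents.

(** * The profile h and its derivatives *)

Section profile.
Context {R : realType}.
Implicit Types (d u : R).

Lemma is_derive_sqr (f : R -> R) (x a : R) : is_derive x 1 f a ->
  is_derive x 1 (fun y => f y ^+ 2) (2 * f x * a).
Proof.
by move=> fa; apply: (is_derive_eq (is_derive_mul fa fa)); ring.
Qed.

Definition prof d u := cotS d u / (1 + cotD d u ^+ 2).
Definition kprof d u := prof d u * cotD d u.
Definition dprof d u : R :=
  - (1 + pr d * prof d u ^+ 2 - 3 * pr d * kprof d u ^+ 2 + 2 * d * kprof d u).
(* Minus the derivative of [kprof d]. *)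
Definition opp_dkprof d u : R :=
  cotD d u * (1 - pr d * kprof d u ^+ 2 + d * kprof d u)
  - prof d u * (d - 3 * pr d * kprof d u).

Lemma sqrD1_gt0 (x : R) : 0 < 1 + x ^+ 2.
Proof. by rewrite ltr_pwDl// sqr_ge0. Qed.

Lemma is_derive_sqrD1 d u : 0 <= d < 1 -> 0 < u < pi ->
  is_derive u 1 (fun x => 1 + cotD d x ^+ 2)
    (2 * cotD d u * (d * (1 + cotD d u ^+ 2) - 2 * pr d * cotS d u * cotD d u)).
Proof.
move=> d01 u0pi.
apply: (is_derive_eq (is_derive_add (is_derive_const 1 u)
  (is_derive_sqr (is_derive_cotD d01 u0pi)))).
by rewrite add0r.
Qed.

Section derivatives.
Variables (d u : R).
Hypotheses (d01 : 0 <= d < 1) (u0pi : 0 < u < pi).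

Lemma is_derive_prof : is_derive u 1 (prof d) (dprof d u).
Proof.
have E0 := sqrD1_gt0 (cotD d u); have E1 : 1 + cotD d u ^+ 2 != 0 by rewrite gt_eqF.
apply: (is_derive_eq (is_derive_div (is_derive_cotS d01 u0pi) (is_derive_sqrD1 d01 u0pi) E1)).
by rewrite /dprof /kprof /prof; field.
Qed.

Lemma is_derive_kprof : is_derive u 1 (kprof d) (- opp_dkprof d u).
Proof.
have E0 := sqrD1_gt0 (cotD d u); have E1 : 1 + cotD d u ^+ 2 != 0 by rewrite gt_eqF.
apply: (is_derive_eq (is_derive_mul is_derive_prof (is_derive_cotD d01 u0pi))).
by rewrite /opp_dkprof /dprof /kprof /prof; field.
Qed.

Lemma prof_gt0 : 0 < prof d u.
Proof. by rewrite divr_gt0 ?cotS_gt0 ?sqrD1_gt0. Qed.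

Lemma kprof_ge0 : 0 <= kprof d u.
Proof. by rewrite mulr_ge0 ?cotD_ge0// ltW// prof_gt0. Qed.

Lemma is_derive_dprof : is_derive u 1 (dprof d)
  (2 * pr d * prof d u * - dprof d u + 2 * opp_dkprof d u * (d - 3 * pr d * kprof d u)).
Proof.
have P := is_derive_scale (pr d) (is_derive_sqr is_derive_prof).
have K := is_derive_scale (3 * pr d) (is_derive_sqr is_derive_kprof).
have L := is_derive_scale (2 * d) is_derive_kprof.
apply: (is_derive_eq (is_derive_opp
   (is_derive_add (is_derive_sub (is_derive_add (is_derive_const 1 u) P) K) L))).
by ring.
Qed.

End derivatives.

(** * Signs of the derivatives of [prof] and [kprof] *)

Section sign.
Variables (d : R).
Hypotheses (d01 : 0 <= d < 1).

Let d0 : 0 <= d. Proof. by case/andP: d01. Qed.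
Let d1 : d < 1. Proof. by case/andP: d01. Qed.
Let p0 : 0 < pr d. Proof. exact: pr_gt0. Qed.
Let p14 : pr d <= 1 / 4. Proof. by rewrite /pr; nra. Qed.

(* The comparison is applied to [cos_gap d * (1 + D ^ 2) * (d - 3 p k)]: the
   factor [cos_gap d] makes it small near [0], yet its logarithmic derivative
   [2 p N - d D] is dominated by the damping coefficient [3 p N]. *)
Lemma kprof_le u : 0 < u < pi -> 3 * pr d * kprof d u <= d.
Proof.
move=> u0pi.
pose N := cotS d; pose D := cotD d; pose p := pr d.
pose M x := d * (1 + D x ^+ 2) - 3 * p * N x * D x.
pose G x := cos_gap d x * M x.
pose dD x := d * (1 + D x ^+ 2) - 2 * p * N x * D x.
(* Since [dD] = [M] + p N D, the terms in N^2 D cancel in the derivative of [M]. This leaves a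
   damping term in [G] and a nonnegative remainder. *)
pose dG x := - (p * N x + d * D x) * G x
  + cos_gap d x * D x * (2 * d * dD x + 3 * p * (1 + D x ^+ 2)).
have Y0 x : 0 < x < pi -> 0 < cos_gap d x.
  by move=> /andP[x0 xpi]; rewrite cos_gap_gt0// x0 ltW.
suff : 0 <= G u.
  rewrite /G pmulr_rge0 ?Y0// /M /kprof /prof subr_ge0.
  rewrite (_ : 3 * pr d * (_ / _ * _) = 3 * p * N u * D u / (1 + D u ^+ 2)).
    by rewrite ler_pdivrMr ?sqrD1_gt0.
  by rewrite /N /D /p; field; rewrite gt_eqF ?sqrD1_gt0.
apply: (@ge0_of_derive_ge0_where_lt0 _ G dG pi) u0pi => {u}.
- move=> u u0pi.
  have E := is_derive_scale d (is_derive_sqrD1 d01 u0pi).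
  have F := is_derive_mul (is_derive_scale (3 * p) (is_derive_cotS d01 u0pi))
    (is_derive_cotD d01 u0pi).
  apply: (is_derive_eq (is_derive_mul (is_derive_cos_gapE d01 u0pi) (is_derive_sub E F))).
  by rewrite /dG /G /M /dD /N /D /p; ring.
- move=> u u0pi Glt0; rewrite /dG addr_ge0//.
    rewrite mulNr -mulrN; apply: mulr_ge0; last lra.
    apply: addr_ge0; apply: mulr_ge0 => //; first exact: ltW.
      exact/ltW/cotS_gt0.
    exact: cotD_ge0.
  apply: mulr_ge0; first by apply: mulr_ge0; [exact/ltW/Y0|exact: cotD_ge0].
  apply: addr_ge0; apply: mulr_ge0.
  + by rewrite mulr_ge0.
  + exact: derive_cotD_ge0.
  + by rewrite mulr_ge0// ltW.
  + exact/ltW/sqrD1_gt0.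
(* As [cos_gap] N = 2 sin u, the only term of [G u] that can be negative is - 6 p D sin u. The
   bounds p <= 1/4, sin u <= 1 and D <= u give [G u] >= - 2 u. The cap 1 keeps u below pi / 2, where
   [cotD_le] holds. *)
- move=> e e0; exists (Num.min (e / 2) 1); first by rewrite lt_min ltr01 andbT; lra.
  move=> u; rewrite lt_min => /andP[u0 /andP[ue u1]] upi.
  have u0pi : 0 < u < pi by rewrite u0.
  have upi2 : u <= pi / 2 by rewrite (le_trans (ltW u1))// pihalf_ge1.
  have Du := cotD_le d01 u0pi upi2.
  have D0 := cotD_ge0 d01 u0pi.
  have -> : G u = cos_gap d u * (d * (1 + D u ^+ 2)) - 6 * p * sin u * D u.
    by rewrite /G /M /N /cotS -/D; field; rewrite gt_eqF// Y0.
  have : 0 <= cos_gap d u * (d * (1 + D u ^+ 2)).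
    by apply: mulr_ge0; [exact/ltW/Y0|apply: mulr_ge0 => //; exact/ltW/sqrD1_gt0].
  have : 6 * p * sin u * D u <= 2 * 1 * u.
    have s0 : 0 <= sin u by rewrite ltW// sin_gt0_pi.
    apply: ler_pM => //.
    - by apply: mulr_ge0 => //; apply: mulr_ge0 => //; exact: ltW.
    - apply: ler_pM => //; first by apply: mulr_ge0 => //; exact: ltW.
      by move: p14; rewrite -/p; lra.
    - by rewrite (le_trans Du)// ler_piMl// ltW.
  lra.
Qed.

(** The bracket in [dprof] is 1 + p h^2 + k (d - 3 p k) + d k. *)
Lemma dprof_le0 u : 0 < u < pi -> dprof d u <= 0.
Proof.
move=> u0pi; have := kprof_le u0pi; have := kprof_ge0 d01 u0pi.
set k := kprof d u => k0 k1; rewrite /dprof -/k oppr_le0.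
have : 0 <= pr d * prof d u ^+ 2 by rewrite mulr_ge0 ?sqr_ge0// ltW.
have : 0 <= k * (d - 3 * pr d * k) by rewrite mulr_ge0// subr_ge0.
have : 0 <= d * k by rewrite mulr_ge0.
lra.
Qed.

(** This factor of D in [opp_dkprof] equals 1 + k (d - 3 p k) + 2 p k^2. *)
Lemma kprof_factor_ge1 u : 0 < u < pi -> 1 <= 1 - pr d * kprof d u ^+ 2 + d * kprof d u.
Proof.
move=> u0pi; have := kprof_le u0pi; have := kprof_ge0 d01 u0pi.
set k := kprof d u => k0 k1.
have : 0 <= k * (d - 3 * pr d * k) by rewrite mulr_ge0// subr_ge0.
have : 0 <= pr d * k ^+ 2 by rewrite mulr_ge0 ?sqr_ge0// ltW.
lra.
Qed.

(* Same weight as in [kprof_le]; that the damping coefficient [c] below remains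
   nonnegative follows from [derive_cotD_ge0]. *)
Lemma opp_dkprof_ge0 u : 0 < u < pi -> 0 <= opp_dkprof d u.
Proof.
move=> u0pi.
pose N := cotS d; pose D := cotD d; pose p := pr d; pose k := kprof d; pose h := prof d.
pose dD x := d * (1 + D x ^+ 2) - 2 * p * N x * D x.
have Y0 x : 0 < x < pi -> 0 < cos_gap d x.
  by move=> /andP[x0 xpi]; rewrite cos_gap_gt0// x0 ltW.
pose Q x := cos_gap d x * opp_dkprof d x.
(* Here - [c] is the sum of 2 p N - d D, coming from the weight, and of - (d D + 3 p h - 2 p k D),
   coming from the derivative of [opp_dkprof]. *)
pose c x := (2 * D x * (d * (1 + D x ^+ 2) - 2 * p * N x * D x) + p * N x) / (1 + D x ^+ 2).
pose dQ x := - c x * Q x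
  + cos_gap d x * (dD x * (1 - p * k x ^+ 2 + d * k x) + - dprof d x * (d - 3 * p * k x)).
suff : 0 <= Q u by rewrite pmulr_rge0// Y0.
apply: (@ge0_of_derive_ge0_where_lt0 _ Q dQ pi) u0pi => {u}.
- move=> u u0pi.
  have E0 := sqrD1_gt0 (cotD d u); have E1 : 1 + cotD d u ^+ 2 != 0 by rewrite gt_eqF.
  have K := is_derive_kprof d01 u0pi.
  have A := is_derive_mul (is_derive_cotD d01 u0pi)
    (is_derive_add (is_derive_sub (is_derive_const 1 u)
      (is_derive_scale p (is_derive_sqr K))) (is_derive_scale d K)).
  have B := is_derive_mul (is_derive_prof d01 u0pi)
    (is_derive_sub (is_derive_const d u) (is_derive_scale (3 * p) K)).
  apply: (is_derive_eq (is_derive_mul (is_derive_cos_gapE d01 u0pi) (is_derive_sub A B))).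
  by rewrite /dQ /c /Q /dD /k /opp_dkprof /dprof /kprof /prof /N /D /p; field.
- move=> u u0pi Qlt0.
  have k1 := kprof_factor_ge1 u0pi.
  rewrite /dQ addr_ge0//.
    rewrite mulNr -mulrN; apply: mulr_ge0; last lra.
    apply: divr_ge0; last exact/ltW/sqrD1_gt0.
    apply: addr_ge0; apply: mulr_ge0.
    + by rewrite mulr_ge0// cotD_ge0.
    + exact: derive_cotD_ge0.
    + exact: ltW.
    + exact/ltW/cotS_gt0.
  apply: mulr_ge0; first exact/ltW/Y0.
  apply: addr_ge0; apply: mulr_ge0.
  + exact: derive_cotD_ge0.
  + exact: le_trans k1.
  + by rewrite oppr_ge0 dprof_le0.
  + by rewrite subr_ge0 kprof_le.
(* The part that can be negative is bounded by [cos_gap] N = 2 sin u, because h <= N and d - 3 p k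
   <= 1. *)
- move=> e e0; exists (e / 2) => [|u /andP[u0 ue] upi]; first lra.
  have u0pi : 0 < u < pi by rewrite u0.
  have k1 := kprof_factor_ge1 u0pi.
  have k2 := kprof_ge0 d01 u0pi.
  have : 0 <= cos_gap d u * (D u * (1 - p * k u ^+ 2 + d * k u)).
    apply: mulr_ge0; first exact/ltW/Y0.
    by apply: mulr_ge0; [exact: cotD_ge0|exact: le_trans k1].
  have : cos_gap d u * (h u * (d - 3 * p * k u)) <= 2 * u.
    have s0 : 0 < sin u by exact: sin_gt0_pi.
    apply: (@le_trans _ _ (cos_gap d u * (N u * 1))).
      rewrite ler_pM2l ?Y0//; apply: ler_pM.
      - exact/ltW/prof_gt0.
      - by rewrite subr_ge0 kprof_le.
      - rewrite /h /prof -/N ler_pdivrMr ?sqrD1_gt0// ler_peMr//.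
          exact/ltW/cotS_gt0.
        by rewrite lerDl sqr_ge0.
      - have : 0 <= p * k u by rewrite mulr_ge0// ltW.
        by have := d1; lra.
    rewrite mulr1 /N /cotS mulrC divfK ?gt_eqF ?Y0// ler_pM2l// sin_le_id// ltW//.
  rewrite /Q /opp_dkprof -/D -/p -/k -/h mulrBr; lra.
Qed.

(** This is the convexity of h on (0, pi). *)
Lemma dprof_homo x y : 0 < x -> x <= y -> y < pi -> dprof d x <= dprof d y.
Proof.
apply: (derive_ge0_homo (fun u => is_derive_dprof d01 (u := u))) => u u0pi.
apply: addr_ge0; apply: mulr_ge0.
- by rewrite mulr_ge0 ?(ltW (prof_gt0 _ _))// mulr_ge0// ltW.
- by rewrite oppr_ge0 dprof_le0.
- by rewrite mulr_ge0// opp_dkprof_ge0.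
- by rewrite subr_ge0 kprof_le.
Qed.

End sign.
End profile.

(** * The function [w_fun] *)

Section w_fun.
Context {R : realType}.
Implicit Types (d u x : R).

(** Changing the sign of d exchanges a and b: [cotS] is unchanged and [cotD] changes sign. Hence 1 -
    2 alpha can be replaced by its absolute value, which satisfies the hypothesis 0 <= d of the
    comparison arguments. *)
Lemma profN d u : prof (- d) u = prof d u.
Proof.
rewrite /prof /cotS /cotD /cos_gap /sin_gap mulNr cosN sinN.
congr (_ / (1 + _)).
rewrite (_ : - sin (d * u) - - d * sin u = - (sin (d * u) - d * sin u)); last ring.
by rewrite mulNr sqrrN.
Qed.

Lemma is_derive_ln_sin k u : 0 < sin (k * u) ->
  is_derive u 1 (fun x => ln (sin (k * x))) (k * (cos (k * u) / sin (k * u))).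
Proof.
move=> s0; have := is_derive1_comp (is_derive1_ln s0) (is_derive_sin_scale k u).
by move=> /is_derive_eq; apply; ring.
Qed.

Variable alpha : R.
Hypothesis alpha01 : 0 < alpha < 1.
Local Notation beta := (1 - alpha).
Local Notation e := `|1 - 2 * alpha|.
Local Notation x0 := (ln (beta * alpha `^ (alpha / beta))).

Let alpha0 : 0 < alpha. Proof. by case/andP: alpha01. Qed.
Let alpha1 : alpha < 1. Proof. by case/andP: alpha01. Qed.
Let beta0 : 0 < beta. Proof. by rewrite subr_gt0. Qed.
Let beta1 : beta <= 1. Proof. by rewrite lerBlDr lerDl ltW. Qed.

Lemma norm_1B2_itv : 0 <= e < 1.
Proof.
have := alpha0; have := alpha1 => a1 a0.
by rewrite normr_ge0/= ltr_norml; apply/andP; split; lra.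
Qed.

Lemma prof_norm u : prof e u = prof (1 - 2 * alpha) u.
Proof. by case: (ger0P (1 - 2 * alpha)) => // _; rewrite profN. Qed.

Let sin_gt0 k u : 0 < k <= 1 -> 0 < u < pi -> 0 < sin (k * u).
Proof.
move=> /andP[k0 k1] /andP[u0 upi]; apply: sin_gt0_pi; rewrite mulr_gt0//=.
by rewrite (le_lt_trans _ upi)// ler_piMl// ltW.
Qed.

Lemma w_funE u : 0 < u < pi -> w_fun alpha u =
  - beta^-1 * (ln (sin u) - alpha * ln (sin (alpha * u)) - beta * ln (sin (beta * u))).
Proof.
move=> u0pi; have s0 : 0 < sin u by exact: sin_gt0_pi.
have sa0 : 0 < sin (alpha * u) by apply: sin_gt0 => //; rewrite alpha0 ltW.
have sb0 : 0 < sin (beta * u) by apply: sin_gt0 => //; rewrite beta0.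
rewrite /w_fun /v_fun /b_fun ln_powR lnM ?posrE ?powR_gt0 ?divr_gt0//.
rewrite !ln_powR !ln_div ?posrE//; ring.
Qed.

(** With x = cot a and y = cot b, beta W' = alpha^2 x + beta^2 y - cot (a + b). Multiplied by x + y
    this becomes 1 + (alpha x - beta y)^2. *)
Lemma is_derive_w_fun u : 0 < u < pi ->
  is_derive u 1 (w_fun alpha) (beta * prof e u)^-1.
Proof.
move=> u0pi; have s0 : 0 < sin u by exact: sin_gt0_pi.
have sa0 : 0 < sin (alpha * u) by apply: sin_gt0 => //; rewrite alpha0 ltW.
have sb0 : 0 < sin (beta * u) by apply: sin_gt0 => //; rewrite beta0.
(* The factor 1 lets [is_derive_ln_sin] treat the three logarithms alike. *)
pose g x := - beta^-1 *
  (ln (sin (1 * x)) - alpha * ln (sin (alpha * x)) - beta * ln (sin (beta * x))).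
have dg : is_derive u 1 g (beta * prof e u)^-1.
  have s1 : 0 < sin (1 * u) by rewrite mul1r.
  apply: (is_derive_eq (is_derive_scale (- beta^-1) (is_derive_sub (is_derive_sub
    (is_derive_ln_sin s1) (is_derive_scale alpha (is_derive_ln_sin sa0)))
    (is_derive_scale beta (is_derive_ln_sin sb0))))).
  rewrite prof_norm !mul1r /prof /cotS /cotD /cos_gap /sin_gap.
  have uE : u = alpha * u + beta * u by ring.
  have dE : (1 - 2 * alpha) * u = beta * u - alpha * u by ring.
  rewrite dE cosB sinB.
  have : sin u = sin (alpha * u) * cos (beta * u) + cos (alpha * u) * sin (beta * u).
    by rewrite {1}uE sinD.
  have : cos u = cos (alpha * u) * cos (beta * u) - sin (alpha * u) * sin (beta * u).
    by rewrite {1}uE cosD.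
  move: s0 sa0 sb0.
  move: (sin u) (cos u) (sin (alpha * u)) (cos (alpha * u)) (sin (beta * u)) (cos (beta * u)).
  move=> S C sa ca sb cb S0 sa0 sb0 CE SE.
  have -> : cb * ca + sb * sa - C = 2 * sa * sb by rewrite CE; ring.
  have := beta0 => b0.
  have E0 : 0 < (2 * sa * sb) ^+ 2 + (sb * ca - cb * sa - (1 - 2 * alpha) * S) ^+ 2.
    by rewrite ltr_pwDl ?sqr_ge0// exprn_gt0// !mulr_gt0.
  rewrite SE in S0 E0 *; rewrite CE.
  by field; rewrite (gt_eqF E0) !gt_eqF.
have u_itv : u \in `]0, pi[ by rewrite in_itv.
apply: near_eq_is_derive dg; near=> x; rewrite w_funE /g ?mul1r//.
have : x \in `]0, pi[ by near: x; exact: near_in_itvoo.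
by rewrite in_itv.
Unshelve. all: by end_near. Qed.

Lemma w_fun_gt x y : 0 < x -> x < y -> y < pi -> w_fun alpha x < w_fun alpha y.
Proof.
apply: (derive_gt0_homo is_derive_w_fun) => u u0pi.
by rewrite invr_gt0 mulr_gt0// prof_gt0// norm_1B2_itv.
Qed.

Lemma ln_w_left_endpoint : x0 = ln beta + alpha / beta * ln alpha.
Proof. by rewrite lnM ?posrE ?powR_gt0// ln_powR. Qed.

(** Concavity gives ln sin (k u) >= ln k + ln sin u for k = alpha, beta. In the average with weights
    alpha and beta the terms ln sin u cancel, and beta x0 is left. *)
Lemma w_fun_ge_left u : 0 < u < pi -> x0 <= w_fun alpha u.
Proof.
move=> u0pi; have s0 : 0 < sin u by exact: sin_gt0_pi.
have u0pi' : 0 <= u <= pi by case/andP: u0pi => /ltW -> /ltW.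
have hl k : 0 < k -> k <= 1 -> ln k + ln (sin u) <= ln (sin (k * u)).
  move=> k0 k1; rewrite -lnM ?posrE// ler_ln ?posrE ?mulr_gt0//.
    by apply: ler_sin_scale => //; rewrite ltW.
  by apply: sin_gt0 => //; rewrite k0.
rewrite w_funE// ln_w_left_endpoint.
have ha := hl _ alpha0 (ltW alpha1).
have hb : ln beta + ln (sin u) <= ln (sin (beta * u)) by exact: hl.
rewrite -(ler_pM2l beta0) mulrA mulrN divff ?gt_eqF// mulrDr mulrA mulrCA divff ?gt_eqF//.
have := ler_wpM2l (ltW alpha0) ha.
have := ler_wpM2l (ltW beta0) hb.
lra.
Qed.

Lemma w_fun_gt_left u : 0 < u < pi -> x0 < w_fun alpha u.
Proof.
move=> /andP[u0 upi]; have u2 : u / 2 < u by lra.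
apply: (@le_lt_trans _ _ (w_fun alpha (u / 2))).
  by apply: w_fun_ge_left; apply/andP; split; lra.
by apply: w_fun_gt => //; lra.
Qed.

(** From sin u >= u cos u and sin (k u) <= k u one gets beta (w - x0) <= - ln cos u, which tends to
    0 with u. This dictates the threshold on cos u. *)
Lemma w_fun_lt_near_0 x : x0 < x -> exists2 u, 0 < u < pi & w_fun alpha u < x.
Proof.
move=> x0x.
have y1 : expR (- (beta * (x - x0))) < cos 0.
  by rewrite cos0 expR_lt1 oppr_lt0; apply: mulr_gt0; rewrite ?subr_gt0.
have : \forall u \near (0 : R), expR (- (beta * (x - x0))) < cos u.
  exact: (cvgr_gt (cos 0) (@continuous_cos R 0) _ y1).
rewrite -nbhs_nearE => /nbhs_ballP[r /= r0 hr].
pose u := Num.min (r / 2) 1.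
have u0 : 0 < u by rewrite lt_min ltr01 andbT divr_gt0.
have ur : u < r by rewrite gt_min; apply/orP; left; lra.
have u1 : u <= 1 by rewrite ge_min lexx orbT.
have := @pihalf_ge1 R => pi2.
have u0pi : 0 < u < pi by apply/andP; split; lra.
exists u => //.
have cu : expR (- (beta * (x - x0))) < cos u.
  by apply: hr; rewrite /ball/= sub0r normrN gtr0_norm.
have cu0 : 0 < cos u by exact: lt_trans (expR_gt0 _) cu.
have s0 : 0 < sin u by exact: sin_gt0_pi.
have hs : u * cos u <= sin u.
  have [c /andP[c0 cu']] := @MVT_cc _ (@sin R) (@cos R) 0 u u0.
  rewrite sin0 !subr0 => ->; rewrite mulrC ler_wpM2r// ?(ltW u0)//.
  by rewrite ltW// ltr_cos// in_itv/=; apply/andP; split; lra.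
have hl k : 0 < k -> k <= 1 -> ln (sin (k * u)) <= ln k + ln u.
  move=> k0 k1; rewrite -lnM ?posrE// ler_ln ?posrE ?mulr_gt0//.
    by apply: sin_le_id; rewrite mulr_ge0// ltW.
  by apply: sin_gt0 => //; rewrite k0.
have ha := hl _ alpha0 (ltW alpha1).
have hb : ln (sin (beta * u)) <= ln beta + ln u by exact: hl.
have hS : ln u + ln (cos u) <= ln (sin u).
  by rewrite -lnM ?posrE// ler_ln ?posrE ?mulr_gt0.
have hc : - (beta * (x - x0)) < ln (cos u) by rewrite -ltr_expR lnK.
have ga := ler_wpM2l (ltW alpha0) ha.
have gb := ler_wpM2l (ltW beta0) hb.
rewrite w_funE// -(ltr_pM2l beta0) mulrA mulrN divff ?gt_eqF//.
have : beta * x0 = beta * ln beta + alpha * ln alpha.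
  by rewrite ln_w_left_endpoint; field; rewrite gt_eqF.
lra.
Qed.

(** Near pi, sin u tends to 0 while sin (alpha u) and sin (beta u) stay above half their values at
    pi. *)
Lemma w_fun_gt_near_pi x : exists2 u, 0 < u < pi & x < w_fun alpha u.
Proof.
have pi0 := @pi_gt0 R.
have hl k u : 0 < k < 1 -> pi / 2 <= u < pi ->
    ln (2^-1 * sin (k * pi)) <= ln (sin (k * u)).
  move=> /andP[k0 k1] /andP[u1 u2].
  have kp : 0 < sin (k * pi).
    by apply: sin_gt0_pi; rewrite mulr_gt0//= gtr_pMl.
  rewrite ler_ln ?posrE; first last.
  - by apply: sin_gt0; [rewrite k0 ltW|apply/andP; split; lra].
  - by rewrite mulr_gt0.
  apply: (@le_trans _ _ (u / pi * sin (k * pi))).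
    by rewrite ler_wpM2r ?(ltW kp)// ler_pdivlMr//; lra.
  rewrite (_ : k * u = u / pi * (k * pi)); last first.
    by rewrite mulrCA divfK// gt_eqF.
  apply: ler_sin_scale.
    apply/andP; split; first by apply: divr_ge0; lra.
    by rewrite ler_pdivrMr// mul1r ltW.
  by rewrite mulr_ge0 ?(ltW k0) ?(ltW pi0)//= ler_piMl ?ltW.
pose K := alpha * ln (2^-1 * sin (alpha * pi)) + beta * ln (2^-1 * sin (beta * pi)).
(* [K] bounds the weighted sum of the two other logarithms from below, so sin u = sin r <= r < expR
   (K - beta x) gives beta w > beta x. *)
pose r := Num.min (pi / 2) (expR (K - beta * x) / 2).
have r0 : 0 < r by rewrite lt_min !divr_gt0// expR_gt0.
have r1 : r <= pi / 2 by rewrite ge_min lexx.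
have r2 : r < expR (K - beta * x).
  by rewrite gt_min; apply/orP; right; rewrite gtr_pMr ?expR_gt0// invf_lt1// ltr1n.
exists (pi - r); first by apply/andP; split; lra.
have u0pi : 0 < pi - r < pi by apply/andP; split; lra.
have s0 : 0 < sin (pi - r) by exact: sin_gt0_pi.
rewrite w_funE// -(ltr_pM2l beta0) mulrA mulrN divff ?gt_eqF//.
have ha : ln (2^-1 * sin (alpha * pi)) <= ln (sin (alpha * (pi - r))).
  by apply: hl => //; apply/andP; split; lra.
have hb : ln (2^-1 * sin (beta * pi)) <= ln (sin (beta * (pi - r))).
  apply: hl; last by apply/andP; split; lra.
  by rewrite beta0 ltrBlDr ltrDl.
have hS : ln (sin (pi - r)) < K - beta * x.
  rewrite -ltr_expR lnK ?posrE//; apply: le_lt_trans r2.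
  have -> : sin (pi - r) = sin r by rewrite sinB sinpi cospi; ring.
  by apply: sin_le_id; exact: ltW.
have ga := ler_wpM2l (ltW alpha0) ha.
have gb := ler_wpM2l (ltW beta0) hb.
move: hS; rewrite /K; lra.
Qed.

End w_fun.

(** * Image of the uniform law under an increasing function *)

Section integral_measure.
Context {R : realType}.
Variable f : R -> \bar R.

(** The proofs [mf] and [f0] are arguments so that a measure structure can be attached to the term,
    as [measure_unique] requires below. *)
Definition integral_measure (mf : measurable_fun [set: R] f)
  (f0 : forall x, (0 <= f x)%E) (A : set R) : \bar R :=
  (\int[lebesgue_measure]_(x in A) f x)%E.

Hypotheses (mf : measurable_fun [set: R] f) (f0 : forall x, (0 <= f x)%E).

Let integral_measure0 : integral_measure mf f0 set0 = 0%E.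
Proof. exact: integral_set0. Qed.

Let integral_measure_ge0 A : (0 <= integral_measure mf f0 A)%E.
Proof. by apply: integral_ge0 => x _. Qed.

Let integral_measure_sigma_additive : semi_sigma_additive (integral_measure mf f0).
Proof.
move=> /= F mF tF mUF; rewrite /integral_measure; apply: cvg_toP.
  apply: ereal_nondecreasing_is_cvgn => m n mn.
  by apply: lee_sum_nneg_natr => // k _ _; apply: integral_ge0 => x _.
by rewrite ge0_integral_bigcup//=; exact: measurable_funTS.
Qed.

HB.instance Definition _ := isMeasure.Build _ _ _ (integral_measure mf f0)
  integral_measure0 integral_measure_ge0 integral_measure_sigma_additive.

End integral_measure.

Section uniform.
Context {R : realType}.
Variables (a b : R) (ab : a < b).
Local Notation up := (uniform_prob ab).

(** The part of [A] outside ]a, b[ has no mass: within the closed interval that carries the density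
    it lies in {a, b}. *)
Lemma uniform_prob_oo (A : set R) : measurable A -> up A = up (A `&` `]a, b[).
Proof.
move=> mA.
have mI : measurable (A `&` `]a, b[) by exact: measurableI.
have mD : measurable (A `\` `]a, b[) by exact: measurableD.
have up0 : up (A `\` `]a, b[) = 0%E.
  rewrite /uniform_prob integral_uniform_pdf.
  have sub : (A `\` `]a, b[) `&` `[a, b] `<=` [set a] `|` [set b].
    move=> x [[_ /=]]; rewrite !in_itv/= => /negP + /andP[ax xb].
    rewrite negb_and -!leNgt => /orP[xa|bx]; [left|right].
      by apply/eqP; rewrite eq_le xa ax.
    by apply/eqP; rewrite eq_le xb bx.
  apply: null_set_integral.
  - exact: measurableI.
  - by apply: measurable_funTS; apply: measurableT_comp => //; exact: measurable_uniform_pdf.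
  - apply: countable_lebesgue_measure0.
    apply: sub_countable (finite_set_countable (finite_set2 a b)).
    exact: subset_card_le.
have AE : A = (A `&` `]a, b[) `|` (A `\` `]a, b[) by rewrite setUIDK.
rewrite [in LHS]AE measureU//; last by rewrite setDE setIACA setICr setI0.
by rewrite /= up0 adde0.
Qed.

(** The two quotients are kept apart to match the boundary values of the primitive in
    [integral_w_dens]. *)
Lemma uniform_prob_co c : a < c < b -> up `[c, b[ = (b / (b - a) - c / (b - a))%:E.
Proof.
move=> /andP[ac cb]; rewrite /uniform_prob.
rewrite (eq_integral (cst (b - a)^-1%:E)); last first.
  move=> x; rewrite inE/= in_itv/= => /andP[cx xb].
  by rewrite /uniform_pdf (ltW (lt_le_trans ac cx)) (ltW xb).
rewrite integral_cst//= lebesgue_measure_itv/= lte_fin cb -EFinD -EFinM.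
by congr EFin; ring.
Qed.

End uniform.

(** * Inverse and image density of an increasing bijection onto an open half-line *)

Section increasing_image.
Context {R : realType}.
Variables (a b x0 : R) (w dw : R -> R).
Hypotheses (dwE : forall u, a < u < b -> is_derive u 1 w (dw u))
  (dw_gt0 : forall u, a < u < b -> 0 < dw u)
  (dw_cont : forall u, a < u < b -> {for u, continuous dw})
  (w_gt : forall u, a < u < b -> x0 < w u)
  (w_lt_neara : forall x, x0 < x -> exists2 u, a < u < b & w u < x)
  (w_gt_nearb : forall x, exists2 u, a < u < b & x < w u).

(* Outside [`]x0, +oo[] the value is the junk point [a]. *)
Definition w_inv x := xget a [set u | a < u < b /\ w u = x].

Lemma w_lt u v : a < u -> u < v -> v < b -> w u < w v.
Proof. exact: derive_gt0_homo dwE dw_gt0 u v. Qed.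

Lemma w_ltE u v : a < u < b -> a < v < b -> (w u < w v) = (u < v).
Proof.
move=> /andP[au ub] /andP[av vb].
have [uv|vu|->] := ltgtP u v; last by rewrite ltxx.
  exact: w_lt.
by apply/negbTE; rewrite -leNgt ltW// w_lt.
Qed.

Lemma w_inj u v : a < u < b -> a < v < b -> w u = w v -> u = v.
Proof.
move=> uab vab E; have [uv|vu|//] := ltgtP u v.
- by move: uv; rewrite -w_ltE// E ltxx.
- by move: vu; rewrite -w_ltE// E ltxx.
Qed.

Lemma w_surj x : x0 < x -> exists u, a < u < b /\ w u = x.
Proof.
move=> x0x; have [u /andP[au ub] wu] := w_lt_neara x0x.
have [v /andP[av vb] wv] := w_gt_nearb x.
have uv : u < v by rewrite -w_ltE ?au ?av//; exact: lt_trans wv.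
have [||z] := @IVT R w u v x (ltW uv).
- apply: derivable_within_continuous => z; rewrite in_itv/= => /andP[uz zv].
  by apply: ex_derive; apply: dwE; rewrite (lt_le_trans au)//= (le_lt_trans zv).
- by rewrite ge_min le_max (ltW wu) (ltW wv) orbT.
- rewrite in_itv/= => /andP[uz zv] wz; exists z; split => //.
  by rewrite (lt_le_trans au)//= (le_lt_trans zv).
Qed.

Lemma w_invP x : x0 < x -> a < w_inv x < b /\ w (w_inv x) = x.
Proof.
by move=> x0x; exact: (xgetPex a (w_surj x0x)).
Qed.

Lemma w_inv_itv x : x0 < x -> a < w_inv x < b.
Proof. by case/w_invP. Qed.

Lemma w_invK x : x0 < x -> w (w_inv x) = x.
Proof. by case/w_invP. Qed.

Lemma wK u : a < u < b -> w_inv (w u) = u.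
Proof.
by move=> uab; have [v1 v2] := w_invP (w_gt uab); apply: w_inj.
Qed.

Lemma is_derive_w_inv x : x0 < x -> is_derive x 1 w_inv (dw (w_inv x))^-1.
Proof.
move=> x0x; have gab := w_inv_itv x0x; rewrite -{1}(w_invK x0x).
have nab : \forall u \near w_inv x, u \in `]a, b[ by apply: near_in_itvoo; rewrite in_itv.
apply: is_derive_inverse.
- near=> u; apply: wK; have : u \in `]a, b[ by near: u.
  by rewrite in_itv.
- near=> u; apply: (@is_derive_continuous _ _ _ (dw u)); apply: dwE.
  have : u \in `]a, b[ by near: u.
  by rewrite in_itv.
- exact: dwE.
- by rewrite gt_eqF// dw_gt0.
Unshelve. all: by end_near. Qed.

(** Change of variables: the uniform density 1 / (b - a) over the derivative of [w] at the
    preimage. *)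
Definition w_dens x := ((b - a) * dw (w_inv x))^-1.

Hypothesis ab : a < b.

Lemma w_dens_gt0 x : x0 < x -> 0 < w_dens x.
Proof.
by move=> x0x; rewrite invr_gt0 mulr_gt0 ?subr_gt0// dw_gt0// w_inv_itv.
Qed.

Lemma w_dens_cont x : x0 < x -> {for x, continuous w_dens}.
Proof.
move=> x0x; have gab := w_inv_itv x0x.
apply: continuousV.
  by rewrite /= mulf_neq0 ?gt_eqF ?subr_gt0 ?dw_gt0.
apply: continuousM; first exact: cst_continuous.
apply: continuous_comp; first exact: is_derive_continuous (is_derive_w_inv x0x).
exact: dw_cont.
Qed.

Lemma w_inv_cvgy : w_inv x @[x --> +oo%R] --> b.
Proof.
apply/cvgrPdist_lt => e e0; near=> x.
have x0x : x0 < x by near: x; apply: nbhs_pinfty_gt; rewrite num_real.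
have /andP[ax xb] := w_inv_itv x0x.
rewrite gtr0_norm ?subr_gt0// ltrBlDr -ltrBlDl.
(* If b - e is not above a, every point of ]a, b[ is already within e of b. *)
have [cab|] := boolP (a < b - e < b).
  have : w (b - e) < x by near: x; apply: nbhs_pinfty_gt; rewrite num_real.
  by rewrite -{1}(w_invK x0x) w_ltE ?ax.
rewrite gtrBl e0 andbT -leNgt => h.
exact: le_lt_trans ax.
Unshelve. all: by end_near. Qed.

Lemma integral_w_dens x : x0 < x ->
  (\int[lebesgue_measure]_(y in `[x, +oo[) (w_dens y)%:E =
   (b / (b - a) - w_inv x / (b - a))%:E)%E.
Proof.
move=> x0x; rewrite EFinB.
have dF y (x0y : x0 < y) := is_derive_mul (is_derive_w_inv x0y) (is_derive_const (b - a)^-1 y).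
apply: (@ge0_continuous_FTC2y _ w_dens (fun y => w_inv y / (b - a))).
- by move=> y xy; apply/ltW/w_dens_gt0; exact: lt_le_trans xy.
- apply/continuous_within_itvcyP; split.
    by move=> y; rewrite in_itv/= andbT => xy; apply: w_dens_cont; exact: lt_trans xy.
  by apply: cvg_at_right_filter; exact: w_dens_cont.
- by apply: cvgM; [exact: w_inv_cvgy|exact: cvg_cst].
- by move=> y xy; have [] := dF _ (lt_trans x0x xy).
- apply: cvg_at_right_filter; apply: cvgM; last exact: cvg_cst.
  exact: is_derive_continuous (is_derive_w_inv x0x).
- move=> y; rewrite in_itv/= andbT => xy.
  have [_ dFE] := dF _ (lt_trans x0x xy).
  by rewrite derive1E dFE mulr0 addr0 /w_dens invfM mulrC.
Qed.

(** A single point does not affect integrals. The value +oo at [x0] makes the convexity inequality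
    automatic when [x0] is an end of the segment with positive weight. *)
Definition w_density x : \bar R :=
  if x0 < x then (w_dens x)%:E else if x == x0 then +oo%E else 0%E.

Lemma w_density_ge0 x : (0 <= w_density x)%E.
Proof.
rewrite /w_density; case: ifPn => [x0x|_]; first by rewrite lee_fin ltW// w_dens_gt0.
by case: ifPn.
Qed.

Lemma measurable_w_density : measurable_fun [set: R] w_density.
Proof.
apply: measurable_fun_if => //.
- exact: measurable_fun_ltr.
- rewrite setTI (_ : _ @^-1` _ = `]x0, +oo[%classic); last first.
    by apply/seteqP; split => y /=; rewrite in_itv/= andbT.
  apply/measurable_EFinP; apply: open_continuous_measurable_fun => // y.
  rewrite inE/= in_itv/= andbT; exact: w_dens_cont.
- apply: measurable_funTS; apply: measurable_fun_ifT => //.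
  exact: measurable_fun_eqr.
Qed.

(** The two measures are compared on closed rays, which generate the measurable sets and are stable
    under intersection. *)
Lemma is_density_w (mu : {measure set R -> \bar R}) :
  measurable_fun [set: R] w ->
  (forall A, measurable A -> mu A = uniform_prob ab (w @^-1` A)) ->
  is_density mu w_density.
Proof.
move=> mw muE; split; [exact: measurable_w_density|exact: w_density_ge0|].
pose nu := integral_measure measurable_w_density w_density_ge0.
have mpre A : measurable A -> measurable (w @^-1` A).
  by move=> mA; rewrite -[X in measurable X]setTI; exact: mw.
have ray x : x0 < x -> mu `[x, +oo[%classic = nu `[x, +oo[%classic.
  move=> x0x; have gab := w_inv_itv x0x.
  rewrite muE// uniform_prob_oo; last exact: mpre.
  rewrite (_ : _ `&` _ = `[w_inv x, b[%classic); last first.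
    apply/seteqP; split => u /=; rewrite !in_itv/= ?andbT.
      move=> [xu uab]; rewrite (andP uab).2 andbT leNgt -w_ltE//.
      by rewrite w_invK// -leNgt.
    move=> /andP[gu ub]; have uab : a < u < b by rewrite ub (lt_le_trans _ gu)// (andP gab).1.
    by split => //; rewrite leNgt -{1}(w_invK x0x) w_ltE// -leNgt.
  rewrite uniform_prob_co// -integral_w_dens//.
  apply: eq_integral => y; rewrite inE/= in_itv/= andbT => xy.
  by rewrite /w_density (lt_le_trans x0x).
(* The primitive is available only beyond [x0], so the open ray is exhausted by closed rays starting
   at x0 + 1 / (n + 1). *)
have ray0 : mu `]x0, +oo[%classic = nu `]x0, +oo[%classic.
  have E : `]x0, +oo[%classic = \bigcup_n `[x0 + n.+1%:R^-1, +oo[%classic.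
    by rewrite itvoyEbigcup.
  have nd : nondecreasing_seq (fun n => `[x0 + n.+1%:R^-1, +oo[%classic).
    move=> m n mn; apply/subsetPset => y /=; rewrite !in_itv/= !andbT.
    by apply: le_trans; rewrite lerD2l lef_pV2 ?posrE// ler_nat.
  have h (m : {measure set R -> \bar R}) :
    m `[x0 + n.+1%:R^-1, +oo[%classic @[n --> \oo] --> m `]x0, +oo[%classic.
    by rewrite E; apply: nondecreasing_cvg_mu => //; exact: bigcup_measurable.
  have munu : (fun n => mu `[x0 + n.+1%:R^-1, +oo[%classic) =
              (fun n => nu `[x0 + n.+1%:R^-1, +oo[%classic).
    by apply/funext => n; apply: ray; rewrite ltrDl invr_gt0.
  have := h mu; rewrite munu => hmu.
  by apply: cvg_unique hmu (h nu); exact: ereal_hausdorff.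
apply: (measure_unique (@RGenCInfty.G R) (fun n => `[- n%:R, +oo[%classic) _ _ _ _ mu nu).
- exact: RGenCInfty.measurableE.
- move=> _ _ [x ->] [y ->]; exists (Num.max x y).
  by apply/seteqP; split => z /=; rewrite !in_itv/= !andbT ge_max => /andP.
- by move=> n; eexists.
- apply/seteqP; split => // y _; exists (Num.truncn `|y|).+1 => //=.
  by rewrite in_itv/= andbT lerNl (le_trans (ler_norm _))// normrN ltW// truncnS_gt.
(* When x <= x0 neither measure charges [x, x0]: [w] stays above [x0], and the density is 0 before
   [x0], which is itself a null point. *)
- move=> _ [x ->]; have [/ray//|xx0] := ltP x0 x.
  transitivity (mu `]x0, +oo[%classic).
    have [mx mx0] : measurable `[x, +oo[%classic /\ measurable `]x0, +oo[%classic by [].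
    rewrite (muE _ mx) (muE _ mx0) [LHS](uniform_prob_oo _ (mpre _ mx)).
    rewrite [RHS](uniform_prob_oo _ (mpre _ mx0)).
    congr (uniform_prob ab _); apply/seteqP; split => u /=; rewrite !in_itv/= ?andbT.
      by move=> [xu uab]; split => //; exact: w_gt.
    by move=> [xu uab]; split => //; rewrite (le_trans xx0)// ltW.
  have nu0 : (\int[lebesgue_measure]_(y in `[x, x0]) w_density y = 0)%E.
    rewrite -integral_itv_bndo_bndc; last exact: measurable_funTS measurable_w_density.
    apply: integral0_eq => y /=; rewrite in_itv/= => /andP[_ yx0].
    by rewrite /w_density ltNge ltW//= lt_eqF.
  rewrite ray0 (_ : `[x, +oo[%classic = `[x, x0]%classic `|` `]x0, +oo[%classic); last first.
    by rewrite -itv_bndbnd_setU// bnd_simp.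
  rewrite measureU//=; first by rewrite /integral_measure nu0 add0e.
  apply/seteqP; split => // y [/=]; rewrite !in_itv/= andbT.
  by move=> /andP[_ /le_lt_trans] /[apply]; rewrite ltxx.
- by move=> n; rewrite muE// (le_lt_trans (probability_le1 _ _)) ?ltry//; exact: mpre.
Qed.

End increasing_image.

(** * Log-convexity *)

Section convexity.
Context {R : realType}.

(** The supporting line is taken at [z]. Its slope terms cancel in the average because [z] is the
    barycentre of [x] and [y]. *)
Lemma convex_of_support (x0 : R) (h l : R -> R) :
  (forall x y, x0 < x -> x0 < y -> h x + l x * (y - x) <= h y) ->
  forall x y t, x0 < x -> x0 < y -> 0 <= t <= 1 ->
    h (t * x + (1 - t) * y) <= t * h x + (1 - t) * h y.
Proof.
move=> hl x y t x0x x0y /andP[t0 t1]; pose z := t * x + (1 - t) * y.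
have x0z : x0 < z.
  have : t * x0 + (1 - t) * x0 < z.
    have [t00|tn0] := eqVneq t 0; first by rewrite /z t00; lra.
    have tp : 0 < t by rewrite lt0r tn0.
    apply: ltr_leD; first by rewrite ltr_pM2l.
    by apply: ler_wpM2l; [lra|exact: ltW].
  by apply: le_lt_trans; lra.
rewrite -/z; have s0 : 0 <= 1 - t by lra.
have hx := ler_wpM2l t0 (hl _ _ x0z x0x).
have hy := ler_wpM2l s0 (hl _ _ x0z x0y).
have E : h z = t * (h z + l z * (x - z)) + (1 - t) * (h z + l z * (y - z)).
  by rewrite /z; ring.
by rewrite [leLHS]E; exact: lerD.
Qed.

Lemma log_convex_on_itvcy (x0 : R) (r l : R -> R) (f : R -> \bar R) :
  (forall x, x0 < x -> f x = (r x)%:E) -> f x0 = +oo%E ->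
  (forall x, x0 < x -> 0 < r x) ->
  (forall x y, x0 < x -> x0 < y -> ln (r x) + l x * (y - x) <= ln (r y)) ->
  log_convex_on `[x0, +oo[ f.
Proof.
move=> fr fx0 r0 hl.
have lnf x : x0 < x -> lne (f x) = (ln (r x))%:E.
  by move=> x0x; rewrite fr// lne_EFin// r0.
have lnfx0 : lne (f x0) = +oo%E by rewrite fx0.
have lnfN x : x0 <= x -> lne (f x) != -oo%E.
  by rewrite le_eqVlt => /predU1P[<-|/lnf ->//]; rewrite lnfx0.
split=> [x /=|x y t /=]; rewrite !in_itv/= !andbT.
  by rewrite le_eqVlt => /predU1P[<-|x0x]; [rewrite fx0|rewrite fr// lte_fin r0].
move=> x0x x0y t01; have /andP[t0 t1] := t01.
(* Zero weights are treated apart: as 0 * +oo = 0, an infinite end would no longer make the right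
   side infinite. *)
have [->|tn0] := eqVneq t 0.
  by rewrite mul0r subr0 mul1r add0r mul0e mul1e add0e.
have [->|tn1] := eqVneq t 1.
  by rewrite subrr mul0r mul1r addr0 mul0e mul1e adde0.
have tp : 0 < t by rewrite lt0r tn0.
have sp : 0 < 1 - t by rewrite subr_gt0 lt_neqAle tn1.
(* This excludes the sum of +oo and -oo when an end is [x0]. *)
have mulN (s : R) z : 0 < s -> x0 <= z -> (s%:E * lne (f z))%E != -oo%E.
  move=> s0 /lnfN; case: (lne (f z)) => [q| |]//= _.
  by rewrite gt0_muley// lte_fin.
move: x0x; rewrite le_eqVlt => /predU1P[xE|x0x].
  by rewrite -xE lnfx0 gt0_muley ?lte_fin// addye ?leey// mulN.
move: x0y; rewrite le_eqVlt => /predU1P[yE|x0y].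
  by rewrite -yE lnfx0 gt0_muley ?lte_fin// addey ?leey// mulN// ltW.
rewrite (lnf x)// (lnf y)// lnf.
  rewrite -!EFinM -EFinD lee_fin.
  exact: (@convex_of_support x0 (fun x => ln (r x)) l hl).
have h1 : t * x0 < t * x by rewrite ltr_pM2l.
have h2 : (1 - t) * x0 < (1 - t) * y by rewrite ltr_pM2l.
lra.
Qed.

End convexity.

(** * Supporting lines of the log-density *)

Section support.
Context {R : realType}.
Variable alpha : R.
Hypothesis alpha01 : 0 < alpha < 1.
Local Notation beta := (1 - alpha).
Local Notation e := `|1 - 2 * alpha|.

(** Since w' = 1 / (beta h), the function [psi] has derivative (h' - h'(v)) / h. As h' is
    nondecreasing, [psi] decreases before v and increases after it, hence is minimal at v. *)
Lemma ln_prof_support u v : 0 < u < pi -> 0 < v < pi ->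
  ln (prof e v) + beta * dprof e v * (w_fun alpha u - w_fun alpha v) <= ln (prof e u).
Proof.
move=> u0pi v0pi; have e1 := norm_1B2_itv alpha01.
have b0 : 0 < beta by case/andP: alpha01; rewrite subr_gt0.
pose l := beta * dprof e v.
pose psi x := ln (prof e x) - l * w_fun alpha x.
pose dpsi x := (dprof e x - dprof e v) / prof e x.
have dE x : 0 < x < pi -> is_derive x 1 psi (dpsi x).
  move=> x0pi; have p0 := prof_gt0 e1 x0pi.
  apply: (is_derive_eq (is_derive_sub
     (is_derive1_comp (is_derive1_ln p0) (is_derive_prof e1 x0pi))
     (is_derive_scale l (is_derive_w_fun alpha01 x0pi)))).
  by rewrite /dpsi /l; field; rewrite !gt_eqF.
suff h : psi v <= psi u by rewrite mulrBr addrCA [leLHS]addrC -lerBrDr; exact: h.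
have /andP[u0 upi] := u0pi; have /andP[v0 vpi] := v0pi.
have [uv|vu|->//] := ltgtP u v.
- have [z /andP[uz zv]|c /andP[uc cv] E] := @MVT_cc _ psi dpsi u v uv.
    by apply: dE; rewrite (lt_le_trans u0)//= (le_lt_trans zv).
  have cpi : 0 < c < pi by rewrite (lt_trans u0)//= (lt_trans cv).
  rewrite -subr_le0 E; apply: mulr_le0_ge0; last by rewrite subr_ge0 ltW.
  apply: mulr_le0_ge0; last by rewrite invr_ge0 ltW// prof_gt0.
  by rewrite subr_le0; apply: dprof_homo => //; [exact: lt_trans uc|exact: ltW].
- have [z /andP[vz zu]|c /andP[vc cu] E] := @MVT_cc _ psi dpsi v u vu.
    by apply: dE; rewrite (lt_le_trans v0)//= (le_lt_trans zu).
  have cpi : 0 < c < pi by rewrite (lt_trans v0)//= (lt_trans cu).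
  rewrite -subr_ge0 E; apply: mulr_ge0; last by rewrite subr_ge0 ltW.
  apply: mulr_ge0; last by rewrite invr_ge0 ltW// prof_gt0.
  by rewrite subr_ge0; apply: dprof_homo => //; [exact: ltW|exact: lt_trans upi].
Qed.

End support.

Theorem theorem3p1 (R : realType) (d : measure_display) (T : measurableType d)
    (P : probability T R) (U : {RV P >-> R}) (hU : uniform_0pi U)
    (alpha : R) (halpha : 0 < alpha < 1) :
  exists f : R -> \bar R,
    [/\ is_density (distribution P (W_rv alpha U)) f,
        forall x, ~ W_support alpha x -> f x = 0%E &
        log_convex_on (W_support alpha) f].
Proof.
pose x0 : R := ln ((1 - alpha) * alpha `^ (alpha / (1 - alpha))).
pose dw (u : R) := ((1 - alpha) * prof `|1 - 2 * alpha| u)^-1.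
have b0 : 0 < 1 - alpha by case/andP: halpha; rewrite subr_gt0.
have e1 := norm_1B2_itv halpha.
have p0 := fun u => @prof_gt0 R _ u e1.
have dwE := is_derive_w_fun halpha.
have dw0 u : 0 < u < pi -> 0 < dw u.
  by move=> u0pi; rewrite invr_gt0 mulr_gt0// p0.
have dwc u : 0 < u < pi -> {for u, continuous dw}.
  move=> u0pi; apply: continuousV; first by rewrite /= gt_eqF// mulr_gt0// p0.
  apply: continuousM; first exact: cst_continuous.
  exact: is_derive_continuous (is_derive_prof e1 u0pi).
have wgt := w_fun_gt_left halpha.
have w0 := w_fun_lt_near_0 halpha.
have wpi := w_fun_gt_near_pi halpha.
have gP := w_invP dwE dw0 w0 wpi.
exists (w_density 0 pi x0 (w_fun alpha) dw); split.
- apply: (is_density_w dwE dw0 dwc wgt w0 wpi (ab := pi_gt0 R)).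
    exact: measurable_w_fun.
  move=> A mA; rewrite /= /distribution /pushforward.
  have -> : W_rv alpha U @^-1` A = U @^-1` (w_fun alpha @^-1` A) by [].
  apply: hU; rewrite -[X in measurable X]setTI; exact: measurable_w_fun.
- move=> x /negP; rewrite /W_support /= in_itv/= andbT -ltNge => xx0.
  by rewrite /w_density ltNge ltW//= lt_eqF.
- pose v := w_inv 0 pi (w_fun alpha).
  (* The slope beta h' at the preimage is the derivative of the log-density. *)
  apply: (@log_convex_on_itvcy _ x0 (w_dens 0 pi (w_fun alpha) dw)
    (fun x => (1 - alpha) * dprof `|1 - 2 * alpha| (v x))).
  + by move=> x x0x; rewrite /w_density x0x.
  + by rewrite /w_density ltxx eqxx.
  + by move=> x x0x; exact: (w_dens_gt0 dwE dw0 w0 wpi (pi_gt0 R)).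
  (* The density is (1 - alpha) / pi times h at the preimage, so its logarithm differs from ln h by
     a constant, which cancels in the inequality. *)
  + have lnE x : x0 < x -> ln (w_dens 0 pi (w_fun alpha) dw x) =
        ln ((1 - alpha) / pi) + ln (prof `|1 - 2 * alpha| (v x)).
      move=> x0x; have [vx _] := gP _ x0x.
      have pv := p0 _ vx.
      rewrite /w_dens subr0 /dw invfM invrK mulrA (mulrC pi^-1) lnM ?posrE//.
      by rewrite divr_gt0// pi_gt0.
    move=> x y x0x x0y; rewrite !lnE// -addrA lerD2l.
    have [vx wx] := gP _ x0x; have [vy wy] := gP _ x0y.
    by have := ln_prof_support halpha vy vx; rewrite wx wy.
Qed.
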